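(* (i) Let $I$ be a nondegenerate compact interval and $f:I\to I$ a continuous map. If $(I,f)$ is transitive, then $h(\hat f)=\infty$. (ii) There exist a nondegenerate compact interval $I$ and a sequence $f_{0,\infty}=\{f_n\}_{n=0}^\infty$ of continuous maps $f_n:I\to I$ such that $(I,f_{0,\infty})$ is transitive but $h(\hat f_{0,\infty})=0$.
   Context: Let $(X,d)$ be a compact metric space. A non-autonomous dynamical system $(X,f_{0,\infty})$ is given by a sequence $f_{0,\infty}=\{f_n\}_{n=0}^\infty$ of continuous self-maps of $X$; write $f_0^n=f_{n-1}\circ\cdots\circ f_0$ for $n\ge1$ and $f_0^0=\mathrm{id}$. If $f_n=f$ for all $n$, it is the autonomous system $(X,f)$. It is transitive if for any two nonempty open sets $U,V\subset X$ there is $n\ge1$ with $f_0^n(U)\cap V\neq\emptyset$. $\mathcal{M}(X)$ is the space of all Borel probability measures on $X$ with the Prohorov metric $\mathcal{P}_d(\mu,\nu)=\inf\{\epsilon>0:\mu(A)\le\nu(A^\epsilon)+\epsilon \text{ and } \nu(A)\le\mu(A^\epsilon)+\epsilon \text{ for all Borel } A\subset X\}$, where $A^\epsilon=\{x\in X: d(x,A)<\epsilon\}$; its topology is the weak$^*$-topology and $\mathcal{M}(X)$ is a compact metric space. The induced system $(\mathcal{M}(X),\hat f_{0,\infty})$, $\hat f_{0,\infty}=\{\hat f_n\}_{n=0}^\infty$, consists of the continuous maps $\hat f_n(\mu)(A)=\mu(f_n^{-1}(A))$. Topological entropy: for $n\ge1$ and $\epsilon>0$, a set $E\subset X$ is $(n,\epsilon)$-separated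 if for any $x\ne y$ in $E$ there is $0\le j\le n-1$ with $d(f_0^j(x),f_0^j(y))>\epsilon$. Let $s_n(\epsilon)$ be the maximal cardinality of an $(n,\epsilon)$-separated set. Then $h(f_{0,\infty})=\lim_{\epsilon\to0}\limsup_{n\to\infty}\frac1n\log s_n(\epsilon)$, written $h(f)$ when $f_n=f$ for all $n$. The entropies $h(\hat f)$ and $h(\hat f_{0,\infty})$ are those of the induced systems on $(\mathcal{M}(I),\mathcal{P}_d)$. *)

(* Defs.v *)
From HB Require Import structures.
From mathcomp Require Import all_boot all_order all_algebra.
From mathcomp Require Import all_classical all_reals all_analysis.

Set Implicit Arguments.
Unset Strict Implicit.
Unset Printing Implicit Defensive.

Import Order.TTheory GRing.Theory Num.Theory.
Import numFieldNormedType.Exports.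

Local Open Scope classical_set_scope.
Local Open Scope ring_scope.

(* The library's measurable types are pointed, hence the base point. *)
#[short(type="pointedMetricType")]
HB.structure Definition PointedMetric (K : numDomainType) :=
  {M of Metric K M & isPointed M}.

Section nonautonomous.
Context {T : Type}.
Implicit Type f : nat -> T -> T.

(* f_0^n = f_(n-1) \o ... \o f_0 *)
Fixpoint iterate f n (x : T) : T :=
  if n is m.+1 then f m (iterate f m x) else x.

End nonautonomous.

Definition transitive_system {X : topologicalType} (f : nat -> X -> X) :=
  forall U V : set X, open U -> U !=set0 -> open V -> V !=set0 ->
    exists2 n, (1 <= n)%N & (iterate f n @` U) `&` V !=set0.

Section entropy.
Context {R : realType} {T : Type} (d : T -> T -> R).
Implicit Types (f : nat -> T -> T) (n : nat) (eps : R).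
Local Open Scope ereal_scope.

Definition separated_set f n eps (E : set T) :=
  forall x y, E x -> E y -> x <> y ->
    exists2 j, (j < n)%N & (eps < d (iterate f j x) (iterate f j y))%R.

(* A supremum in \bar R, +oo when the cardinalities are unbounded; it is a
   maximum for continuous maps of a compact metric space. *)
Definition max_separated f n eps : \bar R :=
  ereal_sup [set k%:R%:E | k in
    [set k | exists2 E : set T, separated_set f n eps E & (E #= `I_k)%card]].

(* The value at n = 0 does not affect the limit superior. *)
Definition separated_growth f eps : \bar R :=
  limn_esup (fun n => (n%:R^-1)%:E * lne (max_separated f n eps)).

Definition entropy f : \bar R := lim (separated_growth f eps @[eps --> 0^'+]).

End entropy.

Definition Borel (X : ptopologicalType) : measurableType (@open X).-sigma :=
  g_sigma_algebraType (@open X).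

Section induced_system.
Context {R : realType} {X : ptopologicalType}.

Lemma continuous_Borel_measurable (f : X -> X) : continuous f ->
  measurable_fun [set: Borel X] (f : Borel X -> Borel X).
Proof.
move=> /continuousP cf.
apply: (measurability (@open X : set (set (Borel X)))) => //.
move=> _ [B oB <-]; rewrite setTI; apply: sub_sigma_algebra; exact: cf.
Qed.

Definition continuous_mfun (f : X -> X) (cf : continuous f) :
    {mfun Borel X >-> Borel X} :=
  mfun_Sub (mem_set (continuous_Borel_measurable cf)).

(* mu |-> (A |-> mu (f @^-1` A)) *)
Definition induced_map (f : X -> X) (cf : continuous f)
    (mu : probability (Borel X) R) : probability (Borel X) R :=
  distribution mu (continuous_mfun cf).

Definition induced_system (f : nat -> X -> X)
    (cf : forall n, continuous (f n)) (n : nat) :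
    probability (Borel X) R -> probability (Borel X) R :=
  induced_map (cf n).

End induced_system.

Section prohorov.
Context {R : realType} {X : pointedMetricType R}.
Implicit Types (A : set (Borel X)) (mu nu : probability (Borel X) R).
Local Open Scope ereal_scope.

(* [set x | d(x, A) < eps], with d(x, set0) = +oo *)
Definition open_nbhd A (eps : R) : set (Borel X) :=
  [set x : X | ereal_inf [set (mdist x y)%:E | y in (A : set X)] < eps%:E].

Definition prohorov mu nu : R :=
  inf [set eps : R | (0 < eps)%R /\ forall A, measurable A ->
    mu A <= nu (open_nbhd A eps) + eps%:E /\
    nu A <= mu (open_nbhd A eps) + eps%:E].

End prohorov.

(* The nondegenerate compact interval [a, b] with the subspace topology and the
   distance `|y - x|; nondegeneracy provides the base point. *)
Definition compact_interval {R : realType} {a b : R} (ab : a < b) : Type :=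
  `[a, b]%classic.

Section compact_interval_instances.
Context {R : realType} {a b : R} (ab : a < b).
Local Notation I := (compact_interval ab).

HB.instance Definition _ := PseudoMetric.copy I (set_type `[a, b]%classic).

Let left_endpoint_in : a \in `[a, b]%classic.
Proof. by rewrite mem_setE bound_itvE ltW. Qed.

HB.instance Definition _ :=
  isPointed.Build I (exist _ a left_endpoint_in : `[a, b]%classic).

Let dist (x y : I) : R := `|set_val y - set_val x|.

Let dist_ge0 x y : 0 <= dist x y. Proof. exact: normr_ge0. Qed.

Let dist_positivity x y : dist x y = 0 -> x = y.
Proof. by move=> /normr0_eq0/subr0_eq/val_inj. Qed.

Let ballEdist x e : ball x e = [set y | dist x y < e].
Proof.
rewrite -[LHS]/[set y | `|set_val x - set_val y| < e].
by apply/seteqP; split => y /=; rewrite /dist distrC.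
Qed.

HB.instance Definition _ := @PseudoMetric_isMetric.Build R I
  dist dist_ge0 dist_positivity ballEdist.

End compact_interval_instances.

(* Main.v *)
Require Import Defs.
From mathcomp Require Import all_boot all_order all_algebra.
From mathcomp Require Import all_classical all_reals all_analysis.
From mathcomp Require Import ring lra.

(* (i) A transitive interval map F has an interior fixed point c. If F maps
   another interior point y to c, then transitivity stretches arbitrarily small
   intervals at c over y, and some iterate G = F^m has two disjoint segments
   J0, J1, each mapped by G over their convex hull. Otherwise F exchanges the
   two sides of c; then F^2 is transitive on [a, c] and fixes c, so that it
   cannot in turn exchange the two sides of a fixed point interior to [a, c].
   Every 0-1 word is the itinerary of a point in J0, J1 under G, and a
   combination of k point masses with weights proportional to 1, 2, 4, ...,
   2^(k-1) follows k itineraries at once: the mass of J0 tells which of its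
   points lie in J0. As J0 and J1 are apart, distinct k-tuples of words give
   measures that are Prohorov-separated by a constant depending on k only,
   whence an entropy of at least k ln 2 / m for every k.
   (ii) Constant maps f_n = p_n, with (p_n) dense, are transitive, while all
   orbits of measures coincide from time 1 on; total boundedness of the Prohorov
   metric then bounds s_n(eps) uniformly in n. *)

Set Implicit Arguments.
Unset Strict Implicit.
Unset Printing Implicit Defensive.

Import Order.TTheory GRing.Theory Num.Theory.
Import numFieldNormedType.Exports.

Local Open Scope classical_set_scope.
Local Open Scope ring_scope.

(** * Horseshoes of transitive interval maps *)

Section real_line.
Context {R : realType}.
Implicit Types (F G : R -> R) (a b c x y v : R).

(** The segment with unordered endpoints: below, the second endpoint may lie on either side of a
    fixed point. *)
Definition between x y z := Num.min x y <= z <= Num.max x y.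

Lemma betweenP x y z :
  reflect ((x <= z /\ z <= y) \/ (y <= z /\ z <= x)) (between x y z).
Proof.
rewrite /between; apply: (iffP idP).
  by case: (leP x y) => xy /andP[? ?]; [left|right].
case: (leP x y) => xy [[h1 h2]|[h1 h2]]; apply/andP; split => //; lra.
Qed.

Lemma IVT_between G x y v : continuous G -> between (G x) (G y) v ->
  exists2 z, between x y z & G z = v.
Proof.
move=> cG; wlog xy : x y / x <= y => [wlg|].
  have [|/ltW yx bv] := leP x y; first exact: wlg.
  have [|z zyx <-] := wlg y x yx; first by rewrite /between minC maxC.
  by exists z => //; rewrite /between minC maxC.
have cw : {within `[x, y], continuous G} by exact: continuous_subspaceT.
move=> /(IVT xy cw)[z]; rewrite in_itv/= => /andP[? ?] <-.
by exists z => //; apply/betweenP; left.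
Qed.

Lemma continuous_iter F n : continuous F -> continuous (iter n F).
Proof.
move=> cF; elim: n => [|n IH] x /=; first exact: cvg_id.
by apply: (@continuous_comp _ _ _ (iter n F) F); [exact: IH|exact: cF].
Qed.

Lemma iter_fix F n c : F c = c -> iter n F c = c.
Proof. by move=> Fc; elim: n => //= n ->. Qed.

(** [F] is a map of the whole line, so the open sets are those of [R] and the starting point is
    explicitly confined to the interval. *)
Definition transitive_on F a b := forall U V : set R, open U -> open V ->
  U `&` `]a, b[ !=set0 -> V `&` `]a, b[ !=set0 ->
  exists n t, [/\ (0 < n)%N, a < t < b, U t & V (iter n F t)].

Record transitive_interval_map F a b : Prop := TransitiveIntervalMap {
  tim_lt : a < b ;
  tim_cont : continuous F ;
  tim_stable : forall x, a <= x <= b -> a <= F x <= b ;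
  tim_trans : transitive_on F a b }.

Lemma open_oo x y : open (`]x, y[%classic : set R).
Proof. exact: interval_open. Qed.

(** * Fixed points, returns and coverings under transitivity *)

Section dynamics.
Context F a b (H : transitive_interval_map F a b).

Let cF : continuous F. Proof. exact: tim_cont H. Qed.

Lemma iter_stable n x : a <= x <= b -> a <= iter n F x <= b.
Proof. by move=> axb; elim: n => //= n /(tim_stable H). Qed.

Lemma transitive_itv u v s t : a <= u -> u < v -> v <= b ->
  a <= s -> s < t -> t <= b ->
  exists n z, [/\ (0 < n)%N, u < z < v & s < iter n F z < t].
Proof.
move=> au uv vb as_ st tb.
have [||n [z [n0 zab]]] := tim_trans H (@open_oo u v) (@open_oo s t).
- exists ((u + v) / 2) => /=; split; rewrite in_itv/=; apply/andP; split; lra.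
- exists ((s + t) / 2) => /=; split; rewrite in_itv/=; apply/andP; split; lra.
by rewrite /= !in_itv/= => ? ?; exists n, z.
Qed.

(** A proper subsegment leaves an open interval free at one end of [[a, b]], and transitivity sends
    some point of []u, v[] there. *)
Lemma not_invariant u v : a <= u -> u < v -> v <= b -> (u, v) <> (a, b) ->
  ~ (forall x, u <= x <= v -> u <= F x <= v).
Proof.
move=> au uv vb uvab inv.
have invn n x : u <= x <= v -> u <= iter n F x <= v.
  by move=> uxv; elim: n => //= n /inv.
have [s [t [as_ st tb stuv]]] :
    exists s t, [/\ a <= s, s < t, t <= b & t <= u \/ v <= s].
  have [au'|ua] := ltP a u; first by exists a, u; split => //; [lra|left].
  have [vb'|bv] := ltP v b; first by exists v, b; split => //; [lra|right].
  by case: uvab; congr pair; lra.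
have [n [z [_ /andP[? ?] /andP[? ?]]]] := transitive_itv au uv vb as_ st tb.
have /andP[? ?] : u <= iter n F z <= v by apply: invn; apply/andP; split; lra.
by case: stuv => ?; lra.
Qed.

(** If [x <= F x] held throughout, the right half of [[a, b]] would be invariant; likewise for the
    left half and [F y <= y]. So [F z - z] takes both signs, and its zero lies strictly between the
    two points found. *)
Lemma interior_fixpoint : exists2 c, a < c < b & F c = c.
Proof.
have ab := tim_lt H.
have [x [axb Fx]] : exists x, a <= x <= b /\ F x < x.
  apply: contrapT => nx.
  apply: (@not_invariant ((a + b) / 2) b); [lra|lra|lra| |].
    by case=> ?; lra.
  move=> x /andP[hx xb].
  have /(tim_stable H)/andP[_ ->] : a <= x <= b by apply/andP; split; lra.
  rewrite andbT leNgt; apply/negP => Fx; apply: nx; exists x.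
  by split; [apply/andP; split; lra|lra].
have [y [ayb Fy]] : exists y, a <= y <= b /\ y < F y.
  apply: contrapT => ny.
  apply: (@not_invariant a ((a + b) / 2)); [lra|lra|lra| |].
    by case=> ?; lra.
  move=> y /andP[ay hy].
  have /(tim_stable H)/andP[-> _] : a <= y <= b by apply/andP; split; lra.
  rewrite leNgt; apply/negP => Fy; apply: ny; exists y.
  by split; [apply/andP; split; lra|lra].
have cG : continuous (fun z => F z - z).
  by move=> z; apply: cvgB; [exact: cF|exact: cvg_id].
have [|c /betweenP cxy /subr0_eq Fc] := @IVT_between _ x y 0 cG.
  by apply/betweenP; left; split; lra.
exists c => //.
have cx : c != x by apply/eqP => cx; move: Fx; rewrite -cx Fc; lra.
have cy : c != y by apply/eqP => cy; move: Fy; rewrite -cy Fc; lra.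
move/andP: axb => [? ?]; move/andP: ayb => [? ?].
by case: cxy => -[h1 h2]; apply/andP; split; rewrite lt_neqAle;
  apply/andP; split; try lra;
  apply/eqP => ?; (move/eqP: cx; apply; lra) || (move/eqP: cy; apply; lra).
Qed.

(** Every iterate of the segment from [c] to [e] contains [c], and by transitivity some iterate
    reaches beyond [p] as seen from [c]; the intermediate value theorem then gives [p] itself. *)
Lemma orbit_covers c e p : a <= c <= b -> F c = c -> a <= e <= b -> e != c ->
  a < p < b -> exists n z, between c e z /\ iter n F z = p.
Proof.
move=> acb Fc aeb ec apb; have [->|pc] := eqVneq p c.
  by exists 0%N, c; split => //; apply/betweenP; case: (leP c e) => ?;
    [left|right]; split; lra.
move/andP: (acb) => [ac cb]; move/andP: (aeb) => [ae eb].
move/andP: (apb) => [ap pb].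
have [u [v [au uv vb uvce]]] : exists u v,
    [/\ a <= u, u < v, v <= b & (u = c /\ v = e) \/ (u = e /\ v = c)].
  have [ce|ce|ce] := ltgtP c e; last by rewrite ce eqxx in ec.
    by exists c, e; split => //; left.
  by exists e, c; split => //; right.
have [s [t [as_ st tb stcp]]] : exists s t,
    [/\ a <= s, s < t, t <= b & (c < p /\ s = p) \/ (p < c /\ t = p)].
  have [cp|cp|cp] := ltgtP c p; last by rewrite cp eqxx in pc.
    by exists p, b; split => //; [lra|left].
  by exists a, p; split => //; [lra|right].
have [n [z [_ /andP[uz zv] /andP[sz zt]]]] :=
  transitive_itv au uv vb as_ st tb.
have [|z' /betweenP z'cz z'p] :=
    @IVT_between (iter n F) c z p (continuous_iter (n := n) cF).
  rewrite (iter_fix n Fc); apply/betweenP.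
  by case: stcp => -[? ?]; [left|right]; split; lra.
exists n, z'; split => //; apply/betweenP.
by case: uvce => -[? ?]; case: z'cz => -[? ?]; first [left; lra|right; lra].
Qed.

Lemma return_late N u v : a <= u -> u < v -> v <= b ->
  exists n z, [/\ (N <= n)%N, u < z < v & u < iter n F z < v].
Proof.
move=> au uv vb; elim: N => [|N [n [z [Nn uzv uzv']]]].
  have [n [z [_ ? ?]]] := transitive_itv au uv vb au uv vb.
  by exists n, z.
(* The points of []u, v[] that are back at time [n]: a return to this set at time [m] yields a
   return to []u, v[] at time [n + m]. *)
pose U := `]u, v[%classic `&` (iter n F @^-1` `]u, v[%classic).
have oU : open U.
  apply: openI; first exact: open_oo.
  have /continuousP := continuous_iter (n := n) cF; apply; exact: open_oo.
have U0 : U `&` `]a, b[ !=set0.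
  exists z; split; first by split; rewrite /= in_itv.
  by move/andP: uzv => [? ?]; rewrite /= in_itv/=; apply/andP; split; lra.
have [m [t [m0 _ [+ _] [_ +]]]] := tim_trans H oU oU U0 U0.
rewrite /= !in_itv/= => utv; rewrite -iterD => utv'.
by exists (n + m)%N, t; split => //; rewrite -addn1 leq_add.
Qed.

(** Only covering is asked: [G] may also send points of the two segments outside [[p, s]]. The gap
    [q < r] provides the separation of measures. *)
Definition horseshoe G p q r s := [/\ p <= q, q < r, r <= s &
  forall v, p <= v <= s -> (exists2 x, p <= x <= q & G x = v) /\
                           (exists2 x, r <= x <= s & G x = v)].

(** [F^k] sends [c] and [y] to [c] but some [w] between them to [w' != c], so it folds the segment
    over [[c, w']]. Some [z] there is carried to [y] by a further [F^n]. Preimages [u] and [v] of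
    [z] on the two sides of [w] then give the segments from [c] to [u] and from [v] to [y], both
    stretched over the segment from [c] to [y] by [F^(n + k)]. *)
Lemma homoclinic_horseshoe c y k : a < c < b -> F c = c -> a < y < b ->
  y != c -> iter k F y = c ->
  exists m p q r s, [/\ (0 < m)%N, a <= p, s <= b & horseshoe (iter m F) p q r s].
Proof.
move=> /andP[ac cb] Fc /andP[ay yb] yc Fky.
have k0 : (0 < k)%N by case: k Fky => //= yc'; rewrite yc' eqxx in yc.
have [w wcy Fkw] : exists2 w, between c y w & iter k F w != c.
  apply: contrapT => nw.
  have [u [v [au uv vb uvcy]]] : exists u v,
      [/\ a <= u, u < v, v <= b & (u = c /\ v = y) \/ (u = y /\ v = c)].
    have [?|?|?] := ltgtP c y; last by move/eqP: yc; case.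
      by exists c, y; split => //; [lra|lra|left].
    by exists y, c; split => //; [lra|lra|right].
  (* If [F^k] were constantly [c] on the segment, any return after time [k] would land on the
     endpoint [c], outside the open interval. *)
  have [n [z [kn /andP[uz zv]]]] := return_late k au uv vb.
  rewrite -(subnK kn) iterD.
  have -> : iter k F z = c.
    apply: contrapT => /eqP Fkz; apply: nw; exists z => //; apply/betweenP.
    by case: uvcy => -[? ?]; [left|right]; split; lra.
  rewrite iter_fix// => /andP[? ?].
  by case: uvcy => -[? ?]; lra.
have awb : a <= w <= b.
  by apply/andP; move/betweenP: wcy => [[? ?]|[? ?]]; split; lra.
have /andP[aw' wb'] := iter_stable k awb.
set w' := iter k F w in Fkw aw' wb'.
(* Searching [z] only up to the midpoint forces [z <> w'], hence [u] and [v] differ from [w] and the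
   two segments are disjoint. *)
have ec : (c + w') / 2 != c.
  by apply/eqP => h; move/eqP: Fkw; apply; lra.
have [|||n [z [zb Fnz]]] := @orbit_covers c ((c + w') / 2) y _ Fc _ ec.
- by apply/andP; split; lra.
- by apply/andP; split; lra.
- by apply/andP; split; lra.
have zw' : z <> w'.
  move=> h; move/eqP: Fkw; apply.
  by move: zb; rewrite h => /betweenP[] [? ?]; lra.
have zcw' : between c w' z.
  by apply/betweenP; move/betweenP: zb => [] [? ?]; [left|right]; lra.
have cFk := continuous_iter (n := k) cF.
have [|u ucw Fku] := @IVT_between _ c w z cFk.
  by rewrite (iter_fix k Fc).
have [|v vwy Fkv] := @IVT_between _ w y z cFk.
  by rewrite Fky /between minC maxC.
have uw : u <> w by move=> h; apply: zw'; rewrite -Fku h.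
have vw : v <> w by move=> h; apply: zw'; rewrite -Fkv h.
pose m := (n + k)%N.
have gc : iter m F c = c by exact: iter_fix.
have gy : iter m F y = c by rewrite iterD Fky iter_fix.
have gu : iter m F u = y by rewrite iterD Fku.
have gv : iter m F v = y by rewrite iterD Fkv.
have cg := continuous_iter (n := m) cF.
have m0 : (0 < m)%N by rewrite addn_gt0 k0 orbT.
move/betweenP: wcy => wcy; move/betweenP: ucw => ucw.
move/betweenP: vwy => vwy.
have [cy|cy|cy] := ltgtP c y; last by move/eqP: yc; case.
- have ul : u < w by rewrite lt_neqAle; apply/andP; split; [exact/eqP|lra].
  have vl : w < v.
    by rewrite lt_neqAle eq_sym; apply/andP; split; [exact/eqP|lra].
  exists m, c, u, v, y; split => //; [lra|lra|].
  split; [lra|lra|lra|move=> x /andP[cx xy]]; split.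
    have [|t /betweenP tb tx] := @IVT_between _ c u x cg.
      by rewrite gc gu; apply/betweenP; left; lra.
    by exists t => //; apply/andP; lra.
  have [|t /betweenP tb tx] := @IVT_between _ v y x cg.
    by rewrite gv gy; apply/betweenP; right; lra.
  by exists t => //; apply/andP; lra.
- have ul : w < u.
    by rewrite lt_neqAle eq_sym; apply/andP; split; [exact/eqP|lra].
  have vl : v < w by rewrite lt_neqAle; apply/andP; split; [exact/eqP|lra].
  exists m, y, v, u, c; split => //; [lra|lra|].
  split; [lra|lra|lra|move=> x /andP[cx xy]]; split.
    have [|t /betweenP tb tx] := @IVT_between _ y v x cg.
      by rewrite gy gv; apply/betweenP; right; lra.
    by exists t => //; apply/andP; lra.
  have [|t /betweenP tb tx] := @IVT_between _ u c x cg.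
    by rewrite gu gc; apply/betweenP; left; lra.
  by exists t => //; apply/andP; lra.
Qed.

(** By [side], points whose images lie strictly on opposite sides of [c] are themselves separated by
    [c]. Hence one point whose image stays on its own side forces that whole side to be invariant,
    against transitivity. *)
Lemma no_return_swap c : a < c < b -> F c = c ->
  (forall y, a < y < b -> F y = c -> y = c) ->
  (forall x, a <= x <= c -> c <= F x) /\ (forall x, c <= x <= b -> F x <= c).
Proof.
move=> /andP[ac cb] Fc nret.
have side x y : a <= x <= b -> a <= y <= b -> F x < c -> c < F y ->
    (x < c < y) \/ (y < c < x).
  move=> /andP[ax xb] /andP[ay yb] Fx Fy.
  have [|t /betweenP tb Ft] := @IVT_between _ x y c cF.
    by apply/betweenP; left; lra.
  have tx : t <> x by move=> h; rewrite h in Ft; lra.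
  have ty : t <> y by move=> h; rewrite h in Ft; lra.
  have [xy|xy|xy] := ltgtP x y; last by rewrite xy in Fx; lra.
    have xt : x < t by rewrite lt_neqAle eq_sym; apply/andP; split; [exact/eqP|lra].
    have yt : t < y by rewrite lt_neqAle; apply/andP; split; [exact/eqP|lra].
    have <- : t = c by apply: nret => //; apply/andP; lra.
    by left; apply/andP; lra.
  have xt : t < x by rewrite lt_neqAle; apply/andP; split; [exact/eqP|lra].
  have yt : y < t by rewrite lt_neqAle eq_sym; apply/andP; split; [exact/eqP|lra].
  have <- : t = c by apply: nret => //; apply/andP; lra.
  by right; apply/andP; lra.
split=> x /andP[h1 h2]; rewrite leNgt; apply/negP => Fx.
  apply: (@not_invariant a c); [lra|lra|lra|by case; lra|].
  move=> y /andP[h3 h4]; have ayb : a <= y <= b by apply/andP; lra.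
  have /andP[-> _] := tim_stable H ayb; rewrite /= leNgt; apply/negP => Fy.
  have axb : a <= x <= b by apply/andP; lra.
  by case: (side _ _ axb ayb Fx Fy) => /andP[? ?]; lra.
apply: (@not_invariant c b); [lra|lra|lra|by case; lra|].
move=> y /andP[h3 h4]; have ayb : a <= y <= b by apply/andP; lra.
have /andP[_ ->] := tim_stable H ayb; rewrite andbT leNgt; apply/negP => Fy.
have axb : a <= x <= b by apply/andP; lra.
by case: (side _ _ ayb axb Fy Fx) => /andP[? ?]; lra.
Qed.

Lemma horseshoe_or_swap c : a < c < b -> F c = c ->
  (exists m p q r s, [/\ (0 < m)%N, a <= p, s <= b & horseshoe (iter m F) p q r s])
  \/ ((forall x, a <= x <= c -> c <= F x) /\ (forall x, c <= x <= b -> F x <= c)).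
Proof.
move=> acb Fc.
have [[y [ayb Fy yc]]|ny] :=
    pselect (exists y, [/\ a < y < b, F y = c & y != c]).
  by left; apply: (@homoclinic_horseshoe c y 1).
right; apply: no_return_swap => // y ayb Fy.
by apply: contrapT => /eqP yc; apply: ny; exists y.
Qed.

Lemma square_transitive c : a < c < b ->
  (forall x, a <= x <= c -> c <= F x) -> (forall x, c <= x <= b -> F x <= c) ->
  transitive_interval_map (iter 2 F) a c.
Proof.
move=> /andP[ac cb] left_right right_left.
have stab x : a <= x <= c -> a <= iter 2 F x <= c.
  move=> axc; have /andP[ax xc] := axc.
  have axb : a <= x <= b by apply/andP; lra.
  have /andP[-> _] := iter_stable 2 axb.
  apply: right_left; rewrite left_right//.
  by have /andP[_ ->] := tim_stable H axb.
have stabn n x : a <= x <= c -> a <= iter n (iter 2 F) x <= c.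
  by move=> axc; elim: n => //= n /stab.
split => //; first exact: continuous_iter.
move=> U V oU oV [x [Ux]] + [y [Vy]].
rewrite /= !in_itv/= => axc ayc.
have [||n [t [n0 _ [Ut]]]] := tim_trans H (openI oU (@open_oo a c))
    (openI oV (@open_oo a c)).
- by exists x; split; [split => //; rewrite /= in_itv|rewrite /= in_itv/=; lra].
- by exists y; split; [split => //; rewrite /= in_itv|rewrite /= in_itv/=; lra].
rewrite /= !in_itv/= => /andP[at_ tc] [Vt /andP[at' tc']].
have iter2 j z : iter j (iter 2 F) z = iter j.*2 F z.
  by elim: j => //= j ->.
have atc : a <= t <= c by apply/andP; lra.
(* At an odd time the orbit of a point of [[a, c]] is in [[c, b]], so a visit to []a, c[] occurs at
   an even time. *)
have nE : n = (n./2).*2.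
  rewrite -[LHS](odd_double_half n); have [on|//] := boolP (odd n).
  exfalso; move: tc'; rewrite -(odd_double_half n) on iterD -iter2 /=.
  by have := left_right _ (stabn n./2 _ atc); lra.
exists n./2, t; split => //.
- by rewrite half_gt0; case: (n) n0 nE => // -[].
- by apply/andP.
- by rewrite iter2 -nE.
Qed.

End dynamics.

Lemma transitive_horseshoe F a b : transitive_interval_map F a b ->
  exists m p q r s, [/\ (0 < m)%N, a <= p, s <= b & horseshoe (iter m F) p q r s].
Proof.
move=> H; have [c acb Fc] := interior_fixpoint H.
case: (horseshoe_or_swap H acb Fc) => // -[lr rl].
have H2 := square_transitive H acb lr rl.
have [d /andP[ad dc] Fd] := interior_fixpoint H2.
have adc : a < d < c by apply/andP.
(* A swap around [d] would send [c], which lies to the right of [d], to a point at most [d]; but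
   [F^2] fixes [c]. *)
case: (horseshoe_or_swap H2 adc Fd) => [|[_ /(_ c)]]; last first.
  by rewrite (iter_fix 2 Fc) lexx andbT => /(_ (ltW dc)); lra.
move=> [m [p [q [r [s [m0 ap sc hs]]]]]].
exists (m * 2)%N, p, q, r, s; split => //.
- by rewrite muln_gt0 m0.
- by move/andP: acb => [_ ?]; lra.
- have -> // : iter (m * 2) F = iter m (iter 2 F).
  by apply/funext => x; rewrite iterM.
Qed.

(** A point following the tail of the word is pulled back by [G] into the segment named by the first
    letter. *)
Lemma horseshoe_itinerary G p q r s (w : nat -> bool) n :
  horseshoe G p q r s ->
  exists2 x, p <= x <= s & forall j, (j < n)%N ->
    if w j then p <= iter j G x <= q else r <= iter j G x <= s.
Proof.
move=> [pq qr rs hs]; elim: n w => [|n IH] w.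
  by exists p => //; rewrite lexx/=; lra.
have [x pxs xw] := IH (w \o succn).
have [[y0 y0b Gy0] [y1 y1b Gy1]] := hs _ pxs.
exists (if w 0%N then y0 else y1).
  by case: (w 0%N); [move/andP: y0b|move/andP: y1b] => -[? ?]; apply/andP; lra.
move=> [_|j]; first by case: (w 0%N).
rewrite ltnS => /xw; rewrite /comp iterSr.
by have -> : G (if w 0%N then y0 else y1) = x by case: (w 0%N).
Qed.

End real_line.

(** * Entropy and the Prohorov metric *)

Lemma card_eq_fintype (C : finType) : ([set: C] #= `I_#|C|)%card.
Proof.
apply: (card_eq_trans _ (_ : [set: 'I_#|C|] #= `I_#|C|)%card); last first.
  by rewrite card_eq_sym; exact: card_II.
have -> : [set: 'I_#|C|] = @enum_rank C @` [set: C].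
  by apply/seteqP; split => // i _; exists (enum_val i) => //; exact: enum_valK.
by rewrite card_eq_sym; apply: inj_card_eq => x y _ _; exact: enum_rank_inj.
Qed.

Section entropy_bounds.
Context {R : realType} {T : Type} (d : T -> T -> R).
Implicit Types (f : nat -> T -> T) (C : finType).
Local Open Scope ereal_scope.

(** Points with equal codes are never more than [eps] apart before time [n], so [code] is injective
    on every separated set. *)
Lemma max_separated_le f n eps C (code : T -> C) :
  (forall x y, code x = code y -> forall j, (j < n)%N ->
    (d (iterate f j x) (iterate f j y) <= eps)%R) ->
  max_separated d f n eps <= #|C|%:R%:E.
Proof.
move=> codeP; apply: ge_ereal_sup => _ [k [E sepE Ek] <-].
rewrite lee_fin ler_nat -card_le_II.
have codeE : (code @` E #= E)%card.
  apply: inj_card_eq => x y; rewrite !inE => Ex Ey xy.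
  apply: contrapT => /(sepE _ _ Ex Ey)[j jn].
  by rewrite ltNge codeP.
rewrite -(card_le_eqr (card_eq_fintype C)).
rewrite -(card_le_eql (card_eq_trans codeE Ek)).
exact: subset_card_le.
Qed.

(** Injectivity is a separate hypothesis because [d] is an arbitrary function, possibly nonzero on
    the diagonal. *)
Lemma max_separated_ge f n eps C (g : C -> T) :
  injective g -> (forall c c', c != c' ->
    exists2 j, (j < n)%N &
      (eps < d (iterate f j (g c)) (iterate f j (g c')))%R) ->
  #|C|%:R%:E <= max_separated d f n eps.
Proof.
move=> ginj gsep; apply: ereal_sup_ubound; exists #|C| => //.
exists (range g) => [_ _ [c _ <-] [c' _ <-] gcc'|].
  by apply: gsep; apply/eqP => cc'; apply: gcc'; rewrite cc'.
apply: card_eq_trans (card_eq_fintype C).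
by apply: inj_card_eq => x y _ _; exact: ginj.
Qed.

Lemma max_separated_ge1 f n eps (x : T) : 1 <= max_separated d f n eps.
Proof.
apply: ereal_sup_ubound; exists 1%N => //; exists [set x]; last exact: card_set1.
by move=> _ _ -> ->.
Qed.

Lemma separated_growth_ge f eps m k : (0 < m)%N ->
  (forall n, (2 ^ (k * n.+1))%:R%:E <= max_separated d f (m * n.+1) eps) ->
  (k%:R * ln 2 / m%:R)%:E <= separated_growth d f eps.
Proof.
(* The limit superior is an infimum of suprema over sets [V] containing a tail; the nonzero index
   [m * N.+1] lies in the tail from [N] on and already gives the rate. *)
move=> m0 sep; apply: le_ereal_inf_tmp => _ [V [N _ NV] <-].
apply: le_ereal_sup_tmp; exists
    (((m * N.+1)%:R^-1)%:E * lne (max_separated d f (m * N.+1) eps)).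
  exists (m * N.+1)%N => //; apply: NV.
  by rewrite /= (leq_trans (leqnSn N))// leq_pmull.
have -> : (k%:R * ln 2 / m%:R)%:E =
    ((m * N.+1)%:R^-1)%:E * lne (2 ^ (k * N.+1))%:R%:E :> \bar R.
  rewrite lne_EFin; last by rewrite ltr0n expn_gt0.
  rewrite natrX lnXn// -EFinM; congr EFin.
  rewrite -mulr_natr !natrM; field.
  by rewrite nat1r !pnatr_eq0 -!lt0n m0.
apply: lee_wpmul2l; first by rewrite lee_fin invr_ge0 ler0n.
have mem0 (x : \bar R) : 0 <= x -> x \in `[0%E, +oo%E].
  by move=> x0; rewrite in_itv/= x0 leey.
rewrite lee_lne ?sep//; apply: mem0; first by rewrite lee_fin.
by apply: le_trans (sep N); rewrite lee_fin.
Qed.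

(** The quotients are squeezed between [0] and [ln C / n]; the singleton of [x] keeps the counts at
    least 1 and the logarithms nonnegative. *)
Lemma separated_growth_eq0 f eps (C : R) (x : T) :
  (forall n, max_separated d f n eps <= C%:E) -> separated_growth d f eps = 0.
Proof.
move=> sepC; pose u n := ((n%:R^-1)%:E * lne (max_separated d f n eps)).
have C1 : (1 <= C)%R.
  by rewrite -lee_fin; apply: le_trans (sepC 0%N); exact: max_separated_ge1.
suff u0 : u @ \oo --> 0 by exact: (cvg_limn_einf_sup u0).2.
have nV0 n : 0 <= (n%:R^-1 : R)%:E by rewrite lee_fin invr_ge0 ler0n.
have mem0 (y : \bar R) : 1 <= y -> y \in `[0%E, +oo%E].
  by move=> y1; rewrite in_itv/= leey (le_trans _ y1).
have Cln : lne C%:E = (ln C)%:E by rewrite lne_EFin// (lt_le_trans ltr01).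
apply: (@squeeze_cvge _ _ _ _ (fun=> 0) _ (fun n => (n%:R^-1)%:E * (ln C)%:E)).
- apply: nearW => n; rewrite /u -Cln mule_ge0 ?andTb//; last first.
    by rewrite lne_ge0; exact: max_separated_ge1.
  by apply: lee_wpmul2l => //; rewrite lee_lne ?mem0//; exact: max_separated_ge1.
- exact: cvg_cst.
- rewrite -[X in _ --> X](mul0e (ln C)%:E).
  apply: cvgeZr => //; rewrite -(cvg_shiftS (fun n => (n%:R^-1)%:E)).
  exact: cvge_harmonic.
Qed.

Lemma entropy_eq0 f (x : T) :
  (forall eps, (0 < eps)%R ->
    exists C : R, forall n, max_separated d f n eps <= C%:E) ->
  entropy d f = 0.
Proof.
move=> bnd; apply: lim_near_cst => //.
near=> eps; have [|C sepC] := bnd eps; last exact: separated_growth_eq0 x sepC.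
by near: eps; exact: nbhs_right_gt.
Unshelve. all: by end_near. Qed.

(** The scale [eps0] may shrink as [k] grows, since [eps] tends to 0, while [m] stays fixed; so the
    rates [k.+1 * ln 2 / m] are unbounded. *)
Lemma entropy_eqy f m : (0 < m)%N ->
  (forall k, exists2 eps0, (0 < eps0)%R & forall eps n, (eps < eps0)%R ->
    (2 ^ (k.+1 * n.+1))%:R%:E <= max_separated d f (m * n.+1) eps) ->
  entropy d f = +oo.
Proof.
move=> m0 sep; apply: cvg_lim => //; apply/cvgeyPge => A.
pose c : R := (ln 2 / m%:R)%R.
have c0 : (0 < c)%R by rewrite divr_gt0 ?ltr0n// ln_gt0// ltr1n.
pose k := (Num.bound `|A / c|)%R.
have Ak : (A <= k%:R * c)%R.
  rewrite -ler_pdivrMr// (le_trans (ler_norm _))// ltW//.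
  exact: archi_boundP.
have [eps0 eps00 {}sep] := sep k; near=> eps.
apply: (@le_trans _ _ (k.+1%:R * ln 2 / m%:R)%:E).
  by rewrite lee_fin -mulrA (le_trans Ak)// ler_pM2r// ler_nat.
apply: separated_growth_ge => // n; apply: sep.
by near: eps; exact: nbhs_right_lt.
Unshelve. all: by end_near. Qed.

End entropy_bounds.

(** * Pushforwards and estimates for the Prohorov metric *)

Lemma Borel_open {X : ptopologicalType} (A : set X) :
  open A -> measurable (A : set (Borel X)).
Proof. exact: sub_sigma_algebra. Qed.

Lemma iterate_induced_system {R : realType} {X : ptopologicalType}
    (f : nat -> X -> X) (cf : forall n, continuous (f n)) n
    (mu : probability (Borel X) R) A :
  iterate (induced_system cf) n mu A = mu (iterate f n @^-1` A).
Proof.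
by elim: n A => [|n IH] A //=; rewrite /distribution /pushforward IH.
Qed.

Section prohorov_lemmas.
Context {R : realType} {X : pointedMetricType R}.
Implicit Types (A K : set (Borel X)) (mu nu : probability (Borel X) R).
Local Open Scope ereal_scope.

Lemma open_nbhdP A (eps : R) (x : X) :
  open_nbhd A eps x <-> exists2 y : X, A y & (mdist x y < eps)%R.
Proof.
split=> [/ereal_inf_lt[_ [y Ay <-]]|[y Ay xy]].
  by rewrite lte_fin => ?; exists y.
by apply/ereal_inf_ltP; exists (mdist x y)%:E => //; exists y.
Qed.

Lemma measurable_open_nbhd A (eps : R) : measurable (open_nbhd A eps).
Proof.
apply: Borel_open; rewrite openE => x /open_nbhdP[y Ay xy].
apply/nbhs_ballP; exists (eps - mdist x y)%R; first by rewrite /= subr_gt0.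
move=> z; rewrite ballEmdist/= ltrBrDr => xz; apply/open_nbhdP; exists y => //.
by apply: le_lt_trans (metric_triangle z x y) _; rewrite metric_sym.
Qed.

Lemma sub_open_nbhd A (eps : R) : (0 < eps)%R -> A `<=` open_nbhd A eps.
Proof. by move=> e0 x Ax; apply/open_nbhdP; exists x => //; rewrite mdistxx. Qed.

Lemma prohorovC mu nu : prohorov mu nu = prohorov nu mu.
Proof.
by congr inf; apply/seteqP; split => e [e0 h]; split=> // A /h[].
Qed.

Lemma prohorov_le mu nu (eps : R) : (0 < eps)%R ->
  (forall A, measurable A -> mu A <= nu (open_nbhd A eps) + eps%:E) ->
  (forall A, measurable A -> nu A <= mu (open_nbhd A eps) + eps%:E) ->
  (prohorov mu nu <= eps)%R.
Proof.
move=> e0 h1 h2; apply: ge_inf; first by exists 0%R => e [/ltW].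
by split=> // A mA; split; [exact: h1|exact: h2].
Qed.

Lemma prohorov_le_eq mu nu (eps : R) : (0 < eps)%R -> mu =1 nu ->
  (prohorov mu nu <= eps)%R.
Proof.
move=> e0 mn; apply: prohorov_le => // A mA;
  apply: (@le_trans _ _ (nu A)); rewrite ?mn//.
- apply: lee_paddr; first by rewrite lee_fin ltW.
  by apply: le_measure; rewrite ?inE//; [exact: measurable_open_nbhd|exact: sub_open_nbhd].
- apply: lee_paddr; first by rewrite lee_fin ltW.
  by apply: le_measure; rewrite ?inE//; [exact: measurable_open_nbhd|exact: sub_open_nbhd].
Qed.

(** [K] is a test set: thickening it by less than [eta] gains no [nu]-mass, so an admissible [eps]
    below [eta] has to make up for the excess [delta] of [mu] on [K]. *)
Lemma prohorov_ge mu nu K (eta delta : R) : measurable K ->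
  (forall eps, (0 < eps < eta)%R -> nu (open_nbhd K eps) <= nu K) ->
  nu K + delta%:E <= mu K -> (Num.min eta delta <= prohorov mu nu)%R.
Proof.
move=> mK nuK dK; apply: lb_le_inf.
  (* The infimum is over a nonempty set: 1 is admissible for any two probabilities. *)
  exists 1%R; split=> // A mA.
  by split; apply: lee_paddl => //; exact: probability_le1.
move=> e [e0 /(_ K mK)[mue _]]; rewrite leNgt lt_min; apply/negP => /andP[ee ed].
have : nu K + delta%:E <= nu K + e%:E.
  apply: le_trans dK (le_trans mue _); apply: leeD2r.
  by apply: nuK; rewrite e0.
rewrite leeD2lE ?lee_fin; last exact: fin_num_measure.
by rewrite leNgt ed.
Qed.

(* Enlarging A to the union B of the cells it meets moves points by less than
   eps, and the masses of B under mu and nu differ by at most n * delta. *)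
Lemma le_partition_open_nbhd n (cell : 'I_n -> set (Borel X)) mu nu
    (eps delta : R) A :
  (forall i, measurable (cell i)) -> trivIset setT cell ->
  (forall x, exists i, cell i x) ->
  (forall i (x y : X), cell i x -> cell i y -> (mdist x y < eps)%R) ->
  (n%:R * delta <= eps)%R -> (0 <= delta)%R ->
  (forall i, mu (cell i) <= nu (cell i) + delta%:E) ->
  measurable A -> mu A <= nu (open_nbhd A eps) + eps%:E.
Proof.
move=> mcell tcell ccell dcell ndelta delta0 munu mA.
pose P i := `[< cell i `&` A !=set0 >].
pose B := \big[setU/set0]_(i < n | P i) cell i.
have BE : B = \bigcup_(i in [set` P]) cell i by rewrite bigcup_pred.
have mB : measurable B by apply: bigsetU_measurable.
have AB : A `<=` B.
  move=> x Ax; have [i ix] := ccell x; rewrite BE.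
  by exists i => //=; apply/asboolP; exists x.
have BA : B `<=` open_nbhd A eps.
  move=> x; rewrite BE => -[i /= /asboolP[y [iy Ay]] ix].
  by apply/open_nbhdP; exists y => //; exact: dcell ix iy.
have sumE (m : probability (Borel X) R) : m B = \sum_(i < n | P i) m (cell i).
  apply: measure_bigsetU_ord_cond => //; exact: sub_trivIset tcell.
apply: (@le_trans _ _ (mu B)); first by apply: le_measure; rewrite ?inE.
apply: (@le_trans _ _ (nu B + eps%:E)); last first.
  apply: leeD2r; apply: le_measure; rewrite ?inE//; exact: measurable_open_nbhd.
rewrite !sumE; apply: (@le_trans _ _ (\sum_(i < n | P i) (nu (cell i) + delta%:E))).
  exact: lee_sum.
rewrite big_split/=; apply: leeD2l.
rewrite sumEFin lee_fin; apply: le_trans ndelta.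
rewrite big_mkcond/= -[n in n%:R]card_ord mulr_natl -sumr_const.
by apply: ler_sum => i _; case: ifP.
Qed.

End prohorov_lemmas.

(** * Mixtures of point masses with binary weights *)

Lemma exists_mixture d (T : measurableType d) (R : realType) k (p : nat -> R)
    (x : nat -> T) :
  (forall i, 0 <= p i) -> \sum_(i < k) p i = 1 ->
  exists mu : probability T R,
    forall A, mu A = (\sum_(i < k) p i * (x i \in A)%:R)%:E.
Proof.
move=> p0 p1.
pose mu : {measure set T -> \bar R} := msum (fun i => mscale (NngNum (p0 i)) \d_(x i)) k.
have muE A : mu A = (\sum_(i < k) p i * (x i \in A)%:R)%:E.
  rewrite /mu /= /msum -sumEFin; apply: eq_bigr => i _.
  by rewrite EFinM -[in RHS](diracE R (x i) A).
have mu1 : mu setT = 1%E.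
  by rewrite muE; under eq_bigr do rewrite in_setT mulr1; rewrite p1.
(* Normalization only supplies the probability structure: the total mass is already 1, so neither
   the scaling nor the default Dirac measure changes anything. *)
exists (mnormalize mu \d_(x 0%N)) => A.
by rewrite -muE /= /mnormalize mu1 -/mu onee_eq0/= invr1 mule1.
Qed.

(** Parity determines the lowest bit; halving what remains shifts the expansion. *)
Lemma binary_expansion_inj k (b b' : nat -> bool) :
  (\sum_(i < k) 2 ^ i * b i = \sum_(i < k) 2 ^ i * b' i)%N ->
  forall i, (i < k)%N -> b i = b' i.
Proof.
elim: k b b' => [|k IH] b b'; first by [].
have sumE (c : nat -> bool) : (\sum_(i < k.+1) 2 ^ i * c i =
    c 0 + (\sum_(i < k) 2 ^ i * c i.+1).*2)%N.
  rewrite big_ord_recl expn0 mul1n; congr addn.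
  rewrite -mul2n big_distrr/=; apply: eq_bigr => i _.
  by rewrite /bump/= add1n expnS mulnA.
rewrite !sumE => e.
have b0 : b 0%N = b' 0%N.
  by have /(congr1 odd) := e; rewrite !oddD !odd_double !oddb !addbF.
move: e; rewrite b0 => /addnI/double_inj/(IH (b \o succn) (b' \o succn)) IHk.
by case=> [|i]; [rewrite b0|exact: IHk].
Qed.

Section mixtures.
Context {R : realType} {X : pointedMetricType R}.

(** The mass of [K0] is [N z / D], where the binary digits of [N z] tell which points lie in [K0].
    Different digits thus change this mass by at least [D^-1], and a point of [K1] is too far from
    [K0] to enter a thickening by less than [eta]. *)
Lemma prohorov_mixture_ge k (mu nu : probability (Borel X) R) (x y : nat -> X)
    (K0 K1 : set X) (eta : R) (D := ((\sum_(i < k) 2 ^ i)%N%:R : R)) :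
  (forall A, mu A = (\sum_(i < k) (2 ^ i)%:R / D * (x i \in A)%:R)%:E) ->
  (forall A, nu A = (\sum_(i < k) (2 ^ i)%:R / D * (y i \in A)%:R)%:E) ->
  measurable (K0 : set (Borel X)) ->
  (forall u v, K0 u -> K1 v -> eta <= mdist v u) ->
  (forall i, (i < k)%N -> K0 (x i) \/ K1 (x i)) ->
  (forall i, (i < k)%N -> K0 (y i) \/ K1 (y i)) ->
  (exists2 i, (i < k)%N & (x i \in K0) != (y i \in K0)) ->
  Num.min eta D^-1 <= prohorov mu nu.
Proof.
move=> + + mK0 K01.
pose N (z : nat -> X) := (\sum_(i < k) 2 ^ i * (z i \in K0))%N.
wlog lt_yx : mu nu x y / (N y < N x)%N => [wlg|] muE nuE xK yK [i ik xyi].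
  have [xy|xy|xy] := ltngtP (N x) (N y).
  - by rewrite prohorovC; apply: (wlg nu mu y x) => //; exists i => //; rewrite eq_sym.
  - by apply: (wlg mu nu x y) => //; exists i.
  - move/eqP: xyi; case.
    exact: (@binary_expansion_inj k (fun i => x i \in K0) (fun i => y i \in K0)).
have D0 : 0 < D.
  by rewrite ltr0n; case: (k) ik => // k' _; rewrite big_ord_recl.
have massE (z : nat -> X) :
    \sum_(i < k) (2 ^ i)%:R / D * (z i \in K0)%:R = (N z)%:R / D.
  rewrite natr_sum big_distrl/=; apply: eq_bigr => j _.
  by rewrite natrM mulrAC.
apply: (@prohorov_ge _ _ _ _ K0) => //.
  move=> eps /andP[eps0 epseta]; rewrite !nuE lee_fin; apply: ler_sum => j _.
  apply: ler_wpM2l; first by rewrite divr_ge0// ltW.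
  have [/set_mem/open_nbhdP[u K0u yu]|_] := boolP (_ \in open_nbhd _ _); last first.
    exact: ler0n.
  have [yj|yj] := yK j (ltn_ord j); first by rewrite mem_set.
  by have := K01 _ _ K0u yj; lra.
rewrite muE nuE !massE -EFinD lee_fin -[X in _ + X]mul1r -mulrDl.
by rewrite ler_pM2r ?invr_gt0// natr1 ler_nat.
Qed.

End mixtures.

(** * The interval inside the real line, and its measures *)

Section interval.
Context {R : realType} {a b : R} (ab : a < b).
Local Notation I := (compact_interval ab).

Lemma interval_bounds (u : I) : a <= set_val u <= b.
Proof. by have := set_valP u; rewrite /= in_itv. Qed.

Lemma clamp_subproof (x : R) : Num.max a (Num.min b x) \in `[a, b]%classic.
Proof.
by rewrite mem_setE in_itv/= le_max lexx/= ge_max (ltW ab) ge_min lexx.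
Qed.

(** The nearest-point retraction of the line onto the interval; composing with it extends a self-map
    of the interval to the line. *)
Definition clamp (x : R) : I :=
  (exist _ (Num.max a (Num.min b x)) (clamp_subproof x) : `[a, b]%classic).

Lemma clampK (x : R) : a <= x <= b -> set_val (clamp x) = x.
Proof. by move=> /andP[ax xb]; rewrite -[LHS]/(Num.max a (Num.min b x)) min_r// max_r. Qed.

Lemma clamp_set_val (u : I) : clamp (set_val u) = u.
Proof. by apply: val_inj; exact: clampK (interval_bounds u). Qed.

Lemma set_val_continuous : continuous (set_val : I -> R).
Proof.
move=> u A /nbhs_ballP[e e0 eA].
by apply/(@nbhs_ballP R I); exists e => // v uv; exact: eA.
Qed.

Lemma clamp_continuous : continuous clamp.
Proof.
move=> x; apply/cvg_ballP => e e0; apply/nbhs_ballP; exists e => // y xy.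
change (`|Num.max a (Num.min b x) - Num.max a (Num.min b y)| < e).
have {xy} : `|x - y| < e := xy; rewrite !ltr_norml => /andP[h1 h2].
by case: (leP a (Num.min b x)); case: (leP a (Num.min b y));
  case: (leP b x) => ?; case: (leP b y) => ? ? ?; apply/andP; lra.
Qed.

(** The interval is cut into [n] half-open cells of length at most [eps], and a measure is coded by
    its cell masses rounded down to multiples of [1 / M]. *)
Lemma prohorov_totally_bounded (eps : R) : 0 < eps ->
  exists (C : finType) (code : probability (Borel I) R -> C),
    forall mu nu, code mu = code nu -> prohorov mu nu <= eps.
Proof.
move=> e0; pose t (u : I) := (set_val u - a) / eps.
have t0 u : 0 <= t u.
  by have /andP[? _] := interval_bounds u; rewrite divr_ge0 ?subr_ge0// ltW.
(* The successor makes room for the cell of the right endpoint, whose index is the truncated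
   quotient itself. *)
pose n := (Num.truncn ((b - a) / eps)).+1.
pose cell (i : 'I_n) : set (Borel I) := [set u : I | Num.truncn (t u) = i].
have mcell i : measurable (cell i).
  have ot (r : R) : measurable ([set u : I | t u < r] : set (Borel I)).
    apply: Borel_open.
    have -> : [set u : I | t u < r] = set_val @^-1` [set x | x < a + r * eps].
      apply/seteqP; split => u /=; rewrite /t ltr_pdivrMr// => h; lra.
    have /continuousP := set_val_continuous; apply; exact: open_lt.
  have -> : cell i = [set u : I | t u < i.+1%:R] `\` [set u : I | t u < i%:R].
    apply/seteqP; split => u /=.
      by move/eqP; rewrite truncn_eq// => /andP[h1 h2]; split => //; lra.
    move=> [h1 /negP]; rewrite -leNgt => h2.
    by apply/eqP; rewrite truncn_eq// h2.
  exact: measurableD.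
have tcell : trivIset setT cell.
  by move=> i j _ _ [u [ui uj]]; apply: ord_inj; rewrite -ui -uj.
have ccell u : exists i, cell i u.
  have ult : (Num.truncn (t u) < n)%N.
    rewrite ltnS; apply: le_truncn; rewrite ler_pM2r ?invr_gt0//.
    by have /andP[? ?] := interval_bounds u; lra.
  by exists (Ordinal ult).
have dcell i (u v : I) : cell i u -> cell i v -> mdist u v < eps.
  rewrite -[mdist u v]/(`|set_val v - set_val u|) /cell/=.
  move=> /eqP + /eqP; rewrite !truncn_eq// /t.
  rewrite !ler_pdivlMr// !ltr_pdivrMr// -natr1 mulrDl mul1r.
  by move=> /andP[? ?] /andP[? ?]; rewrite ltr_norml; apply/andP; split; lra.
(* [M] exceeds [n / eps], so [n] rounding errors of at most [1 / M] add up to at most [eps]. *)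
pose M := (Num.truncn (n%:R / eps)).+1.
pose g (mu : probability (Borel I) R) i := Num.truncn (M%:R * fine (mu (cell i))).
pose code (mu : probability (Borel I) R) : {ffun 'I_n -> 'I_M.+1} :=
  [ffun i => inord (g mu i)].
have M0 : 0 < M%:R :> R by rewrite ltr0n.
have muge0 (mu : probability (Borel I) R) i : 0 <= M%:R * fine (mu (cell i)).
  by rewrite mulr_ge0 ?fine_ge0.
have gM mu i : (g mu i < M.+1)%N.
  rewrite ltnS -(@natrK R M); apply: le_truncn; rewrite ger_pMr//.
  rewrite -lee_fin fineK; [exact: probability_le1|exact: fin_num_measure].
have nM : n%:R * M%:R^-1 <= eps.
  rewrite ler_pdivrMr// mulrC -ler_pdivrMr// ltW//.
  have /truncn_itv/andP[_ //] : 0 <= n%:R / eps by rewrite divr_ge0// ltW.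
exists {ffun 'I_n -> 'I_M.+1}, code => mu nu codeE.
have gE i : g mu i = g nu i.
  have /ffunP/(_ i) := codeE; rewrite !ffunE => /(congr1 val).
  by rewrite /= !inordK.
have close (m1 m2 : probability (Borel I) R) : (forall i, g m1 i = g m2 i) ->
    forall i, (m1 (cell i) <= m2 (cell i) + M%:R^-1%:E)%E.
  move=> g12 i; rewrite -(@fineK _ (m1 _)) -1?(@fineK _ (m2 _));
    [|exact: fin_num_measure..].
  rewrite -EFinD lee_fin -(ler_pM2l M0) mulrDr divff ?gt_eqF//.
  have /andP[_ h1] := truncn_itv (muge0 m1 i).
  have /andP[h2 _] := truncn_itv (muge0 m2 i).
  move: h1; rewrite -/(g m1 i) g12 -natr1 => h1.
  by apply: ltW; apply: lt_le_trans h1 _; rewrite lerD2r.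
apply: prohorov_le => // A mA.
- by apply: (le_partition_open_nbhd (cell := cell) (delta := M%:R^-1)) => //; exact: close.
- by apply: (le_partition_open_nbhd (cell := cell) (delta := M%:R^-1)) => //; exact: close.
Qed.

Lemma transitive_clamp (f : I -> I) : continuous f -> transitive_system (fun=> f) ->
  transitive_interval_map (fun x => set_val (f (clamp x))) a b.
Proof.
move=> cf trf; split => //.
- move=> x; apply: (@continuous_comp _ _ _ clamp (set_val \o f)).
    exact: clamp_continuous.
  apply: (@continuous_comp _ _ _ f set_val); [exact: cf|exact: set_val_continuous].
- by move=> x _; exact: interval_bounds.
move=> U V oU oV [x [Ux]] + [y [Vy]]; rewrite /= !in_itv/= => xab yab.
have /continuousP cval := set_val_continuous.
(* Cutting [U] down to []a, b[] makes the starting point interior. *)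
have [||||n n1 [_ [[t [Ut tab] <-] Vt]]] := trf
    (set_val @^-1` (U `&` `]a, b[%classic)) (set_val @^-1` V).
- by apply: cval; apply: openI => //; exact: open_oo.
- exists (clamp x); rewrite /preimage/=.
  by rewrite -[X in U X]/(set_val (clamp x)) clampK ?in_itv//=;
    move/andP: xab => -[? ?]; apply/andP; lra.
- exact: cval.
- exists (clamp y).
  by rewrite /preimage/= -[X in V X]/(set_val (clamp y)) clampK//;
    move/andP: yab => -[? ?]; apply/andP; lra.
exists n, (set_val t); split => //.
suff -> : iter n (fun x => set_val (f (clamp x))) (set_val t) =
  set_val (iterate (fun=> f) n t) by [].
by elim: (n) => //= k ->; rewrite clamp_set_val.
Qed.

End interval.

(** * Induced systems of interval maps *)

Section interval_systems.
Context {R : realType} {a b : R} (ab : a < b).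
Local Notation I := (compact_interval ab).

Lemma measurable_segment (p q : R) :
  measurable ([set u : I | p <= set_val u <= q] : set (Borel I)).
Proof.
have /continuousP cval := @set_val_continuous R a b ab.
have -> : [set u : I | p <= set_val u <= q] =
    ~` ((set_val @^-1` [set x | x < p]) `|` (set_val @^-1` [set x | q < x])).
  apply/seteqP; split => u /=.
    by move=> /andP[h1 h2] [] h; lra.
  by move=> h; apply/andP; split; rewrite leNgt; apply/negP => h'; apply: h;
    [left|right].
by apply: measurableC; apply: measurableU; apply: Borel_open; apply: cval;
  [exact: open_lt|exact: open_gt].
Qed.

Lemma itinerary_point (f : I -> I) m p q r s (w : nat -> bool) n :
  a <= p -> s <= b ->
  horseshoe (iter m (fun x => set_val (f (clamp ab x)))) p q r s ->
  exists u : I, forall j, (j < n)%N ->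
    let v := set_val (iterate (fun=> f) (m * j) u) in
    if w j then p <= v <= q else r <= v <= s.
Proof.
move=> ap sb /(horseshoe_itinerary w n)[x /andP[px xs] xw].
exists (clamp ab x) => j /xw.
have -> // : iter j (iter m (fun x => set_val (f (clamp ab x)))) x =
    set_val (iterate (fun=> f) (m * j) (clamp ab x)).
rewrite -iterM mulnC; elim: (m * j)%N => [|i /= ->]; last by rewrite clamp_set_val.
by rewrite /= clampK//; apply/andP; lra.
Qed.

Lemma transitive_induced_entropy (f : I -> I) (cf : continuous f) :
  transitive_system (fun=> f) ->
  entropy (@prohorov R I) (fun=> induced_map cf) = +oo%E.
Proof.
move=> /(transitive_clamp cf)/transitive_horseshoe.
move=> [m [p [q [r [s [m0 ap sb hs]]]]]].
have [pq qr rs _] := hs.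
apply: (entropy_eqy (m := m)) => // k.
pose D : R := (\sum_(i < k.+1) 2 ^ i)%N%:R.
have D0 : 0 < D by rewrite ltr0n big_ord_recl.
have eps00 : 0 < Num.min (r - q) D^-1 by rewrite lt_min subr_gt0 qr invr_gt0.
exists (Num.min (r - q) D^-1) => // eps n eps_lt.
pose C := {ffun 'I_n.+1 -> {ffun 'I_k.+1 -> bool}}.
(* The letter [c j i] prescribes the segment of the [i]-th point at time [m * j]. The points are
   kept next to the measure since separation is read off from them; those of index above [k],
   governed by the default value of [inord], carry no mass. *)
have /choice[g gP] : forall c : C, exists mx : probability (Borel I) R * (nat -> I),
    (forall A, mx.1 A = (\sum_(i < k.+1) (2 ^ i)%:R / D * (mx.2 i \in A)%:R)%:E) /\
    forall i j, (j < n.+1)%N ->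
      let v := set_val (iterate (fun=> f) (m * j) (mx.2 i)) in
      if c (inord j) (inord i) then p <= v <= q else r <= v <= s.
  move=> c.
  have /choice[x xP] := fun i : nat =>
    itinerary_point (fun j => c (inord j) (inord i)) n.+1 ap sb hs.
  have [||mu muE] := @exists_mixture _ (Borel I) R k.+1 (fun i => (2 ^ i)%:R / D) x.
  - by move=> i; rewrite divr_ge0// ltW.
  - by rewrite /= -mulr_suml (_ : \sum_i _ = D) ?divff ?gt_eqF// /D natr_sum.
  by exists (mu, x).
have sep c c' : c != c' -> exists2 j, (j < m * n.+1)%N &
    Num.min (r - q) D^-1 <= prohorov
      (iterate (fun=> induced_map cf) j (g c).1)
      (iterate (fun=> induced_map cf) j (g c').1).
  move=> cc'.
  have [j [i cji]] : exists j i, c j i != c' j i.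
    apply: contrapT => ncc'; move/eqP: cc'; apply.
    apply/ffunP => j; apply/ffunP => i; apply: contrapT => /eqP h.
    by apply: ncc'; exists j, i.
  exists (m * j)%N; first by rewrite ltn_pmul2l.
  have [muE xP] := gP c; have [nuE yP] := gP c'.
  pose K0 : set I := [set u | p <= set_val u <= q].
  pose K1 : set I := [set u | r <= set_val u <= s].
  have K0E (z : C) (i' : 'I_k.+1) :
      (iterate (fun=> f) (m * j) ((g z).2 i') \in K0) = z j i'.
    have [_ /(_ i' j (ltn_ord j))] := gP z; rewrite !inord_val.
    case: (z j i') => /= h; first by rewrite mem_set.
    by apply/negbTE/negP => /set_mem /=; rewrite /K0/= => h'; lra.
  have K01 (z : C) i' : (i' < k.+1)%N ->
      K0 (iterate (fun=> f) (m * j) ((g z).2 i')) \/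
      K1 (iterate (fun=> f) (m * j) ((g z).2 i')).
    move=> i'k; have [_ /(_ i' j (ltn_ord j))] := gP z.
    by case: (z _ _) => h; [left|right].
  apply: (@prohorov_mixture_ge R I k.+1 _ _
    (fun i => iterate (fun=> f) (m * j) ((g c).2 i))
    (fun i => iterate (fun=> f) (m * j) ((g c').2 i)) K0 K1).
  - move=> A; rewrite (iterate_induced_system (fun=> cf)) muE.
    by [].
  - move=> A; rewrite (iterate_induced_system (fun=> cf)) nuE.
    by [].
  - exact: measurable_segment.
  - move=> u v /andP[_ uq] /andP[rv _].
    rewrite -[mdist v u]/(`|set_val u - set_val v|) distrC.
    by apply: le_trans (ler_norm _); lra.
  - exact: K01.
  - exact: K01.
  - by exists i => //; rewrite !K0E.
have -> : (2 ^ (k.+1 * n.+1))%N = #|C|.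
  by rewrite !card_ffun !card_ord card_bool expnM.
apply: (max_separated_ge (g := fun c => (g c).1)).
(* A common measure for two codes would be at distance at least the positive constant from itself,
   yet also at most half of it. *)
- move=> c c' gcc'; apply: contrapT => /eqP/sep[j _]; rewrite gcc'.
  set mu := iterate _ _ _ => h.
  have : prohorov mu mu <= Num.min (r - q) D^-1 / 2.
    by apply: prohorov_le_eq => //; rewrite divr_gt0.
  by move: eps00 h; lra.
- move=> c c' /sep[j jmn h]; exists j => //; exact: lt_le_trans eps_lt h.
Qed.

(** An enumeration of the rationals, clamped to the interval; a number coding no rational stands for
    0. *)
Lemma dense_sequence : exists p : nat -> I,
  forall V : set I, open V -> V !=set0 -> exists n, V (p n).
Proof.
exists (fun n => clamp ab (ratr (odflt 0%Q (unpickle n)))) => V oV [x Vx].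
have /nbhs_ballP[e /= e0 eV] : nbhs x V by exact: open_nbhs_nbhs.
have /andP[ax xb] := interval_bounds x.
(* A rational of []l, u[] is both within [e] of [x] and unmoved by [clamp]. *)
pose l := Num.max a (set_val x - e); pose u := Num.min b (set_val x + e).
have lu : l < u.
  have ltab : a < b := ab.
  by rewrite /l /u gt_max !lt_min; apply/andP; split; apply/andP; split; lra.
have [t] := rat_in_itvoo lu; rewrite in_itv/= /l /u gt_max lt_min.
move=> /andP[/andP[at_ xt] /andP[tb tx]].
exists (pickle t); rewrite pickleK /=; apply: eV.
change (`|set_val x - set_val (clamp ab (ratr t))| < e).
rewrite clampK; last by apply/andP; lra.
by rewrite ltr_norml; apply/andP; lra.
Qed.

Lemma constant_system_entropy (p : nat -> I)
    (cf : forall n, continuous (fun _ : I => p n)) :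
  entropy (@prohorov R I) (induced_system (f := fun n _ => p n) cf) = 0%E.
Proof.
apply: (entropy_eq0 (\d_(p 0%N : Borel I) : probability (Borel I) R)) => eps eps0.
have [C [code codeP]] := prohorov_totally_bounded ab eps0.
exists #|C|%:R => n; apply: (max_separated_le (code := code)).
move=> mu nu /codeP mn [_|j _]; first exact: mn.
apply: prohorov_le_eq => // A /=; rewrite /distribution /pushforward /=.
rewrite !iterate_induced_system.
(* After time 0 the preimage of [A] is everything or empty, whatever the initial measure; only the
   distance at time 0 needs the code. *)
have [Ap|nAp] := pselect (A (p j)).
  rewrite (_ : _ @^-1` _ = setT) ?probability_setT//.
  by apply/seteqP; split.
rewrite (_ : _ @^-1` _ = set0) ?measure0//.
by apply/seteqP; split.
Qed.

End interval_systems.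

Theorem theorem2p6 (R : realType) :
  (forall (a b : R) (ab : a < b)
      (f : compact_interval ab -> compact_interval ab) (cf : continuous f),
    transitive_system (fun=> f) ->
    entropy (@prohorov R (compact_interval ab)) (fun=> induced_map cf)
      = +oo%E) /\
  (exists (a b : R) (ab : a < b)
      (f : nat -> compact_interval ab -> compact_interval ab)
      (cf : forall n, continuous (f n)),
    transitive_system f /\
    entropy (@prohorov R (compact_interval ab)) (induced_system cf) = 0%E).
Proof.
split=> [a b ab f cf trf|]; first exact: transitive_induced_entropy.
have [p pd] := dense_sequence (@ltr01 R).
exists 0, 1, ltr01, (fun n _ => p n), (fun n => @cst_continuous _ _ (p n)).
split; last exact: constant_system_entropy.
(* At time [n.+1] every point sits at [p n], which density places in [V]. *)
move=> U V oU [u Uu] oV /(pd _ oV)[n Vpn]; exists n.+1 => //.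
by exists (p n); split => //; exists u.
Qed.
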